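(* Let $X$ be a space with a quasiregular H-closed $\pi$-base. Then $X$ is a Baire space.
   Context: All spaces are Hausdorff topological spaces. A space $Y$ is quasiregular if for every non-empty open set $U\subseteq Y$ there is a non-empty open set $V\subseteq Y$ with $\overline{V}\subseteq U$. A space $Y$ is H-closed if it is Hausdorff and closed in every Hausdorff space in which it is embedded; equivalently, $Y$ is Hausdorff and every open cover $\mathcal{U}$ of $Y$ has a finite subfamily $\mathcal{V}\subseteq\mathcal{U}$ with $\overline{\bigcup\mathcal{V}}=Y$. A $\pi$-base of $X$ is a family $\mathcal{B}$ of non-empty open subsets of $X$ such that every non-empty open subset of $X$ contains a member of $\mathcal{B}$. A quasiregular H-closed $\pi$-base is a $\pi$-base $\mathcal{B}$ such that for every $B\in\mathcal{B}$ the closure $\overline{B}$, as a subspace, is both quasiregular and H-closed. A space is Baire if every countable intersection of open dense subsets is dense. *)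

(* Defs.v *)
From HB Require Import structures.
From mathcomp Require Import all_boot all_order all_algebra.
From mathcomp Require Import all_classical.
From mathcomp Require Import topology.

Set Implicit Arguments.
Unset Strict Implicit.
Unset Printing Implicit Defensive.

Local Open Scope classical_set_scope.

Definition quasiregular (Y : topologicalType) : Prop :=
  forall U : set Y, open U -> U !=set0 ->
    exists V : set Y, [/\ open V, V !=set0 & closure V `<=` U].

(* The second clause says that the topology of Y is the one pulled back along
   f from Z, so that f is a homeomorphism onto its range with the subspace
   topology. *)
Definition embedding (Y Z : topologicalType) (f : Y -> Z) : Prop :=
  injective f /\
  forall U : set Y, open U <-> exists2 V : set Z, open V & f @^-1` V = U.

Definition H_closed (Y : topologicalType) : Prop :=
  hausdorff_space Y /\
  forall (Z : topologicalType) (f : Y -> Z),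
    hausdorff_space Z -> embedding f -> closed (range f).

Definition pi_base (X : topologicalType) (B : set (set X)) : Prop :=
  (forall A, B A -> open A /\ A !=set0) /\
  (forall U : set X, open U -> U !=set0 -> exists2 A, B A & A `<=` U).

(* The closure of A as a subspace is the sigma type [set_type (closure A)] with
   the initial topology of the inclusion; [subspace (closure A)] would instead
   be a topology on all of X, in which points outside closure A are isolated. *)
Definition quasiregular_H_closed_pi_base (X : topologicalType)
    (B : set (set X)) : Prop :=
  pi_base B /\
  forall A, B A -> quasiregular (set_type (closure A)) /\
                   H_closed (set_type (closure A)).

Definition Baire_space (X : topologicalType) : Prop :=
  forall G : set (set X), countable G ->
    (forall A, G A -> open A /\ dense A) -> dense (\bigcap_(A in G) A).

(* Main.v *)
Require Import Defs.
From HB Require Import structures.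
From mathcomp Require Import all_boot all_classical topology.

Set Implicit Arguments.
Unset Strict Implicit.
Unset Printing Implicit Defensive.

Local Open Scope classical_set_scope.

(** The closure of a member of the pi-base is a Baire space, and this is enough:
    for [A] open, an open dense set of [X] traces an open dense set on
    [closure A], so a countable intersection of open dense sets of [X] meets the
    open set [A], and every non-empty open set of [X] contains such an [A]
    ([Baire_space_pi_base]).

    For a quasiregular H-closed space [Y] the classical nested-set proof of
    Baire's theorem works ([quasiregular_H_closed_Baire]).  Quasiregularity
    yields non-empty open sets [V n] with [closure (V n.+1)] inside
    [V n `&` G n], and what remains is to find a point common to all the
    closures.  Here H-closedness replaces compactness: a proper filter with a
    base of open sets always has a cluster point
    ([H_closed_open_filter_cluster]).  Otherwise one could add to [Y] a single
    point whose neighborhoods trace the filter on [Y]; the larger space would be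
    Hausdorff because the filter does not cluster, yet [Y] would not be closed
    in it because the filter is proper. *)

(** * Adding a limit point to a filter *)

(** The filter proof is a parameter only so that the topology below can be
    inferred from the type. *)
Definition add_limit (Y : topologicalType) (F : set_system Y)
  (FF : Filter F) : Type := option Y.

Section AddLimit.
Variables (Y : topologicalType) (F : set_system Y) (FF : Filter F).

HB.instance Definition _ := Choice.copy (add_limit FF) (option Y).

Definition add_limit_open (O : set (add_limit FF)) : Prop :=
  open (Some @^-1` O) /\ (O None -> F (Some @^-1` O)).

Let add_limit_openT : add_limit_open setT.
Proof. by split=> [|_]; [exact: openT | exact: filterT]. Qed.

Let add_limit_openI : setI_closed add_limit_open.
Proof.
move=> O P [oO FO] [oP FP]; split; first exact: openI.
by move=> [/FO FO' /FP FP']; exact: filterI.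
Qed.

Let add_limit_open_bigU (I : Type) (f : I -> set (add_limit FF)) :
  (forall i, add_limit_open (f i)) -> add_limit_open (\bigcup_i f i).
Proof.
move=> fo; split.
  by rewrite preimage_bigcup; apply: bigcup_open => i _; exact: (fo i).1.
by move=> [i _ /(fo i).2]; apply: filterS => y fiy; exists i.
Qed.

HB.instance Definition _ := isOpenTopological.Build (add_limit FF)
  add_limit_openT add_limit_openI add_limit_open_bigU.

Lemma add_limit_openE (O : set (add_limit FF)) : open O = add_limit_open O.
Proof. by []. Qed.

Lemma add_limit_embedding : embedding (Some : Y -> add_limit FF).
Proof.
split; first by move=> x y [].
move=> U; split; last by move=> [V [oV _] <-].
have SU : Some @^-1` (Some @` U : set (add_limit FF)) = U.
  by apply/seteqP; split=> [y [z Uz [<-]]|y Uy] //; exists y.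
move=> oU; exists (Some @` U) => //.
by rewrite add_limit_openE; split; [rewrite SU | case].
Qed.

(** The added point can be separated from [y] exactly when [y] is not a cluster
    point; the separating members of [F] can be taken open because [F] has a
    base of open sets. *)
Lemma add_limit_hausdorff : hausdorff_space Y ->
  (forall A, F A -> exists2 U, open U & F U /\ U `<=` A) ->
  cluster F = set0 -> hausdorff_space (add_limit FF).
Proof.
rewrite !open_hausdorff => hY Fopen clF0.
have sep_limit y : exists UV : set Y * set Y,
    [/\ open UV.1, F UV.1, open UV.2, UV.2 y & UV.1 `&` UV.2 = set0].
  apply: contrapT => nsep; suff : cluster F y by rewrite clF0.
  rewrite clusterEonbhs => A V /Fopen[U oU [FU UA]] [oV Vy].
  apply/set0P/negP => /eqP AV0; apply: nsep; exists (U, V); split=> //=.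
  by apply/seteqP; split=> // z [/UA Az Vz]; rewrite -AV0.
have image_open V : open V -> open (Some @` V : set (add_limit FF)).
  move=> oV; rewrite add_limit_openE; split; last by case.
  by rewrite (_ : _ @^-1` _ = V) //; apply/seteqP;
    split=> [y [z Vz [<-]]|y Vy] //; exists y.
have limit_open U : open U -> F U ->
    open ([set None] `|` Some @` U : set (add_limit FF)).
  move=> oU FU; rewrite add_limit_openE /add_limit_open.
  by rewrite (_ : _ @^-1` _ = U) //; apply/seteqP;
    split=> [y [//|[z Uz [<-]]]|y Uy] //; right; exists y.
have disj U V : U `&` V = set0 ->
    ([set None] `|` Some @` U : set (add_limit FF)) `&` Some @` V = set0.
  move=> UV0; apply/seteqP; split=> // _ [[->|[u Uu <-]] [v Vv]] //.
  by case=> vu; suff : (U `&` V) u; [rewrite UV0 | split=> //; rewrite -vu].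
move=> [x|] [y|] // xy.
- have /hY[[U V] /= [xU yV] [oU oV /eqP UV0]] : x != y by apply: contraNneq xy => ->.
  exists (Some @` U, Some @` V) => /=.
    by split; apply/mem_set; [exists x | exists y] => //; exact/set_mem.
  split; [exact: image_open | exact: image_open | apply/eqP].
  by rewrite -subset0 -(disj _ _ UV0) => z [Uz Vz]; split=> //; right.
- have [[U V] /= [oU FU oV Vx /disj UV0]] := sep_limit x.
  exists (Some @` V, [set None] `|` Some @` U) => /=.
    by split; apply/mem_set; [exists x | left].
  by split; [exact: image_open | exact: limit_open | rewrite setIC UV0].
- have [[U V] /= [oU FU oV Vy /disj UV0]] := sep_limit y.
  exists ([set None] `|` Some @` U, Some @` V) => /=.
    by split; apply/mem_set; [left | exists y].
  by split; [exact: limit_open | exact: image_open | rewrite UV0].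
Qed.

(** If the range were closed then the added point would be isolated, so that the
    empty set would belong to [F]. *)
Lemma add_limit_range_not_closed : ProperFilter F ->
  ~ closed (range (Some : Y -> add_limit FF)).
Proof.
move=> FP; rewrite -openC add_limit_openE => -[_ Fr].
apply: (@filter_not_empty _ F); apply: filterS (Fr _).
  by move=> y; apply; exists y.
by case.
Qed.

End AddLimit.

(** * Quasiregular H-closed spaces *)

Lemma H_closed_open_filter_cluster (Y : topologicalType) (F : set_system Y) :
  H_closed Y -> ProperFilter F ->
  (forall A, F A -> exists2 U, open U & F U /\ U `<=` A) ->
  cluster F !=set0.
Proof.
move=> [hY clY] FP Fopen; apply/set0P/negP => /eqP clF0.
apply: (@add_limit_range_not_closed Y F _ FP); apply: clY.
  exact: add_limit_hausdorff.
exact: add_limit_embedding.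
Qed.

Lemma H_closed_nested (Y : topologicalType) (V : nat -> set Y) :
  H_closed Y -> (forall n, open (V n) /\ V n !=set0) ->
  (forall n, V n.+1 `<=` V n) -> \bigcap_n closure (V n) !=set0.
Proof.
move=> hY Vo Vdecr.
have Vmono m n : (m <= n)%N -> V n `<=` V m.
  elim: n => [|n IHn]; first by rewrite leqn0 => /eqP ->.
  rewrite leq_eqVlt => /predU1P[-> //|]; rewrite ltnS => /IHn.
  exact: subset_trans (Vdecr n).
have FF : Filter (filter_from setT V).
  apply: filter_fromT_filter => [|m n]; first by exists 0.
  by exists (maxn m n); rewrite subsetI; split; apply: Vmono;
    rewrite ?leq_maxl ?leq_maxr.
have FP : ProperFilter (filter_from setT V).
  by apply: filter_from_proper => n _; exact: (Vo n).2.
have [|y] := H_closed_open_filter_cluster hY FP.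
  move=> A [n _ VA]; exists (V n); first exact: (Vo n).1.
  by split=> //; exists n.
by rewrite clusterE => cy; exists y => n _; apply: cy; exists n.
Qed.

(** The construction of the nested sets is Baire's, with quasiregularity used
    to shrink each open set. *)
Lemma quasiregular_H_closed_dense_seq (Y : topologicalType)
    (G : nat -> set Y) : quasiregular Y -> H_closed Y ->
  (forall n, open (G n) /\ dense (G n)) -> dense (\bigcap_n G n).
Proof.
move=> qY hY Go U U0 oU.
have shrink (nW : nat * set Y) : exists V, open nW.2 /\ nW.2 !=set0 ->
    [/\ open V, V !=set0 & closure V `<=` nW.2 `&` G nW.1].
  case: nW => n W /=; have [[oW W0]|nW] := pselect (open W /\ W !=set0).
    have [|V VP] := qY _ (openI oW (Go n).1); first exact: (Go n).2.
    by exists V.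
  by exists set0.
have [next nextP] := choice shrink.
pose V := fix V n := if n is m.+1 then next (m, V m) else U.
have Vo n : open (V n) /\ V n !=set0.
  by elim: n => [//|n IHn] /=; have [] := nextP (n, V n) IHn.
have Vcl n : closure (V n.+1) `<=` V n `&` G n.
  by have [] := nextP (n, V n) (Vo n).
have [n|y yV] := H_closed_nested hY Vo.
  by move=> y /subset_closure/Vcl[].
exists y; split=> [|n _].
  by have [] := Vcl 0 y (yV 1 I).
by have [] := Vcl n y (yV n.+1 I).
Qed.

Lemma quasiregular_H_closed_Baire (Y : topologicalType) :
  quasiregular Y -> H_closed Y -> Baire_space Y.
Proof.
move=> qY hY G cG Go.
have [->|[g]] := pfcard_geP cG.
  by rewrite bigcap_set0 => U U0 _; rewrite setIT.
have gG n : G (g n) by exact: funS.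
have gS A : G A -> exists n, g n = A.
  by move=> /(@surj _ _ _ _ g)[n _ <-]; exists n.
have gdense := quasiregular_H_closed_dense_seq qY hY (fun n => Go _ (gG n)).
rewrite (_ : \bigcap_(A in G) A = \bigcap_n g n) //.
apply/seteqP; split=> [y yG n _|y yg A /gS[n <-]]; first exact: yG.
exact: yg.
Qed.

(** * From the members of a pi-base to the whole space *)

(** A point of [closure A] in [W] can be moved inside [A `&` W], which is open in
    [X] and so meets [G]; a subspace that is not the closure of an open set may
    miss [G] entirely. *)
Lemma dense_closure_trace (X : topologicalType) (A G : set X) :
  open A -> dense G -> dense (@set_val X (closure A) @^-1` G).
Proof.
move=> oA dG O [y Oy] [W oW defO]; move: Oy; rewrite -defO => Wy.
have [z [Az Wz]] := set_valP y _ (open_nbhs_nbhs (conj oW Wy)).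
have [x [[Ax Wx] Gx]] : (A `&` W) `&` G !=set0.
  by apply: dG; [exists z | exact: openI].
by exists (SigSub (mem_set (subset_closure Ax))).
Qed.

Lemma Baire_space_pi_base (X : topologicalType) (B : set (set X)) :
  pi_base B -> (forall A, B A -> Baire_space (set_type (closure A))) ->
  Baire_space X.
Proof.
move=> [Bo Bsub] BB G cG Go U U0 oU.
have [A BA AU] := Bsub U oU U0; have [oA [a Aa]] := Bo A BA.
pose tr (D : set X) : set (set_type (closure A)) := set_val @^-1` D.
have [||||y [Ay Gy]] := BB A BA (tr @` G) _ _ (tr A).
- exact: card_le_trans (card_image_le _ _) cG.
- move=> _ [D GD <-]; have [oD dD] := Go D GD.
  by split; [exists D | exact: dense_closure_trace].
- by exists (SigSub (mem_set (subset_closure Aa))).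
- by exists A.
by exists (set_val y); split=> [|D GD]; [exact: AU | apply: (Gy (tr D)); exists D].
Qed.

Theorem theorem4p5 (X : topologicalType) (hX : hausdorff_space X)
    (hB : exists B : set (set X), quasiregular_H_closed_pi_base B) :
  Baire_space X.
Proof.
case: hB => B [piB qhB]; apply: (Baire_space_pi_base piB) => A /qhB[qA hA].
exact: quasiregular_H_closed_Baire.
Qed.
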